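(* Let $\gamma\in\mathrm{SL}_2(\mathbb{Z})$ and let $w\in S_N$ have cycle type $1^{r_1}2^{r_2}\cdots N^{r_N}$. Then \[ \dim_{\mathcal{K}}\Bigl(HH_0(A_N,(A_N)_{w\gamma})_{C_{S_N}(w)}\Bigr)=\prod_{k=1}^N\binom{c_k(\gamma)+r_k-1}{r_k}. \]
   Context: $\mathcal{K}=\mathbb{C}(q)$. A permutation $w$ has cycle type $1^{r_1}\cdots N^{r_N}$ if it is a product of $r_k$ disjoint cycles of length $k$. Identify $\mathbb{Z}^{\oplus N}\otimes\mathbb{Z}^{\oplus2}\cong\mathbb{Z}^{2N}$ with coordinates $(j_1,\ell_1,\dots,j_N,\ell_N)$, on which $w\otimes\gamma$ acts ($S_N$ permuting the pairs $(j_i,\ell_i)$, $\gamma$ acting on each pair). Let $\omega(\mathbf{u},\mathbf{u}')=\sum_i(j_i\ell_i'-\ell_ij_i')$ and let $A_N$ be the $\mathcal{K}$-algebra with basis $m_{\mathbf{u}}$, $\mathbf{u}\in\mathbb{Z}^{2N}$, and product $m_{\mathbf{u}}m_{\mathbf{v}}=q^{\frac12\omega(\mathbf{u},\mathbf{v})}m_{\mathbf{u}+\mathbf{v}}$. Define $HH_0(A_N,(A_N)_{w\gamma})=A_N/\mathcal{K}\{m_{\mathbf{u}}m_{\mathbf{v}}-m_{\mathbf{v}}m_{(w\otimes\gamma)\mathbf{u}}\}$. The centraliser $C_{S_N}(w)$ acts on this space via $\sigma(m_{\mathbf{u}})=m_{\sigma(\mathbf{u})}$, and the subscript denotes coinvariants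 for this action. For $k\ge1$, $c_k(\gamma)$ denotes the number of orbits of the centraliser $C_{S_k}((1\,2\cdots k))=\langle(1\,2\cdots k)\rangle$ acting (via its action on $\mathbb{Z}^{2k}$) on the finite set $\operatorname{coker}(\mathrm{Id}_{2k}-(1\,2\cdots k)\otimes\gamma)_{\mathrm{tors}}$ (torsion subgroup of the cokernel).
   Formalization: The base field is taken to be C(q^{1/2}) instead of C(q), because the product m_u m_v = q^{ω(u,v)/2} m_{u+v} needs q^{1/2}, which does not lie in C(q). *)

(* Defs.v *)
From mathcomp Require Import all_boot all_order all_algebra all_fingroup.
From mathcomp Require Import fraction complex.
From Stdlib Require Import Rdefinitions.
From mathcomp Require Import Rstruct.

Set Implicit Arguments.
Unset Strict Implicit.
Unset Printing Implicit Defensive.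
Import GRing.Theory Num.Theory.
Local Open Scope ring_scope.

Definition CC : closedFieldType := complex Rdefinitions.R.

(* The base field.  K := C(t), the field of rational functions in t := q^(1/2),
   so that q = t^2 and q^(k/2) = t^k for k : int. *)
Definition K : fieldType := {fraction {poly CC}}.
Definition tq : K := tofrac ('X : {poly CC}).

Definition Z2N (N : nat) := {ffun 'I_N -> int * int}.

Definition zadd N (u v : Z2N N) : Z2N N :=
  [ffun i => ((u i).1 + (v i).1, (u i).2 + (v i).2)].

Definition omega N (u v : Z2N N) : int :=
  (\sum_(i < N) ((u i).1 * (v i).2 - (u i).2 * (v i).1 : int)).

Definition gact (g : 'M[int]_2) (p : int * int) : int * int :=
  (g 0 0 * p.1 + g 0 1 * p.2, g 1 0 * p.1 + g 1 1 * p.2).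

(* (s (x) gamma) u : the pair in position s i is gamma applied to the pair in
   position i, i.e. ((s (x) gamma) u)_i = gamma u_{s^-1 i}. *)
Definition wgact N (s : {perm 'I_N}) (g : 'M[int]_2) (u : Z2N N) : Z2N N :=
  [ffun i => gact g (u ((s^-1)%g i))].

Definition pact N (s : {perm 'I_N}) (u : Z2N N) : Z2N N :=
  [ffun i => u ((s^-1)%g i)].

(* Elements of A_N are finite K-linear combinations of basis elements m_u,
   represented as formal finite sums; coef x u = coefficient of m_u in x. *)
Definition elt N := seq (K * Z2N N).
Definition coef N (x : elt N) (u : Z2N N) : K :=
  \sum_(p <- x) (if p.2 == u then p.1 else 0).

Definition mmul N (u v : Z2N N) : elt N := [:: (tq ^ omega u v, zadd u v)].

(* Hochschild relation  m_u m_v - m_v m_{(w (x) gamma) u} *)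
Definition hh_rel N (w : {perm 'I_N}) (g : 'M[int]_2) (u v : Z2N N) : elt N :=
  [:: (tq ^ omega u v, zadd u v);
      (- tq ^ omega v (wgact w g u), zadd v (wgact w g u))].

Definition coinv_rel N (s : {perm 'I_N}) (u : Z2N N) : elt N :=
  [:: (1, pact s u); (-1, u)].

(* f (a function Z^{2N} -> K, the coefficient vector of an element of A_N)
   lies in the subspace W spanned by all the Hochschild relations and all the
   coinvariant relations for sigma in the centraliser C_{S_N}(w).
   A_N / W = HH_0(A_N,(A_N)_{w gamma})_{C_{S_N}(w)}. *)
Definition in_W N (w : {perm 'I_N}) (g : 'M[int]_2) (f : Z2N N -> K) : Prop :=
  exists (l1 : seq (K * (Z2N N * Z2N N))) (l2 : seq (K * ({perm 'I_N} * Z2N N))),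
    (forall p, p \in l2 -> p.2.1 \in 'C[w]%g) /\
    forall x : Z2N N,
      f x = \sum_(p <- l1) p.1 * coef (hh_rel w g p.2.1 p.2.2) x
          + \sum_(p <- l2) p.1 * coef (coinv_rel p.2.1 p.2.2) x.

Definition coinv_HH0_dim N (w : {perm 'I_N}) (g : 'M[int]_2) (d : nat) : Prop :=
  exists b : 'I_d -> elt N,
    (forall u : Z2N N, exists lam : 'I_d -> K,
        in_W w g (fun x => (x == u)%:R - \sum_(i < d) lam i * coef (b i) x)) /\
    (forall lam : 'I_d -> K,
        in_W w g (fun x => \sum_(i < d) lam i * coef (b i) x) ->
        forall i, lam i = 0).

Definition cyc_count N (w : {perm 'I_N}) (k : nat) : nat :=
  #|[set c in porbits w | #|c| == k]|.

Definition kcycle (k : nat) : {perm 'I_k} := perm (@ordS_inj k).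

Definition in_imM k (g : 'M[int]_2) (x : Z2N k) : Prop :=
  exists y : Z2N k, forall i, x i = ((y i).1 - (wgact (kcycle k) g y i).1,
                                     (y i).2 - (wgact (kcycle k) g y i).2).

Definition zsub N (u v : Z2N N) : Z2N N :=
  [ffun i => ((u i).1 - (v i).1, (u i).2 - (v i).2)].
Definition zscale N (n : nat) (u : Z2N N) : Z2N N :=
  [ffun i => ((u i).1 *+ n, (u i).2 *+ n)].

(* x represents an element of the torsion subgroup of the cokernel *)
Definition is_tors k (g : 'M[int]_2) (x : Z2N k) : Prop :=
  exists n : nat, (0 < n)%nat /\ in_imM g (zscale n x).

Definition same_orbit k (g : 'M[int]_2) (x y : Z2N k) : Prop :=
  exists j : nat, in_imM g (zsub (pact ((kcycle k) ^+ j)%g x) y).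

Definition orbit_count k (g : 'M[int]_2) (m : nat) : Prop :=
  exists reps : 'I_m -> Z2N k,
    (forall i, is_tors g (reps i)) /\
    (forall i j, same_orbit g (reps i) (reps j) -> i = j) /\
    (forall x, is_tors g x -> exists i, same_orbit g x (reps i)).

(* Main.v *)
Require Import Defs.
From HB Require Import structures.
From mathcomp Require Import all_boot all_order all_algebra all_fingroup.
From mathcomp Require Import boolp ring fraction.
(* [Defs.gact] would otherwise be hidden by the [gact] of the action library. *)
Import Defs.

Set Implicit Arguments.
Unset Strict Implicit.
Unset Printing Implicit Defensive.
Import GRing.Theory Num.Theory.

(* Write phi for w (x) gamma and t for q^(1/2). Substituting x = u + v, the
   Hochschild relations say that m_x and m_(x - (u - phi u)) differ by an
   explicit power of t. If x is not torsion in the cokernel of 1 - phi, some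
   k fixed by phi has omega(k, x) <> 0, and the relation for k kills m_x. On
   torsion classes the powers of t are consistent: if n x = y - phi y, then
   Q(x) = omega(y, phi y) / n^2 is well defined, invariant under C(w), and
   t^Q(x) scales exactly like the relations, so every torsion orbit carries a
   nonzero functional. Hence the dimension is the number of C(w)-orbits on the
   torsion of the cokernel of 1 - phi. Restricting to the cycles of w, where
   C(w) acts by rotating cycles and permuting those of equal length, such an
   orbit amounts to a multiset of r_k elements among c_k, for each k. *)

(** * Colourings up to permutation *)

Lemma map_nth_index (T : eqType) (U : Type) (u0 : U) (e : seq T) (s : seq U) :
  uniq e -> size s = size e -> [seq nth u0 s (index x e) | x <- e] = s.
Proof.
move=> ue se; apply: (@eq_from_nth _ u0); first by rewrite size_map.
rewrite size_map => i ie; case: e ue se ie => // x0 e ue se ie.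
by rewrite (nth_map x0) // index_uniq.
Qed.

Lemma perm_eq_map_perm (T : eqType) n (f f' : 'I_n -> T) :
  perm_eq [seq f j | j <- enum 'I_n] [seq f' j | j <- enum 'I_n] ->
  exists p : {perm 'I_n}, forall j, f j = f' (p j).
Proof.
move=> ff'; have : perm_eq [tuple f j | j < n] [tuple f' j | j < n] by [].
move=> /tuple_permP [p hp]; exists p => j.
by have := congr1 (fun t => tnth t j) (val_inj hp); rewrite !tnth_mktuple.
Qed.

Section Colourings.
Variables (n N : nat) (len : 'I_n -> nat) (c : nat -> nat).
Hypothesis len_range : forall j, 0 < len j <= N.
Hypothesis c_gt0 : forall k, 0 < k <= N -> 0 < c k.

Definition level k : seq 'I_n := [seq j <- enum 'I_n | len j == k].

Lemma level_uniq k : uniq (level k).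
Proof. by rewrite filter_uniq // enum_uniq. Qed.

Lemma mem_level k j : (j \in level k) = (len j == k).
Proof. by rewrite mem_filter mem_enum andbT. Qed.

Lemma size_level k : size (level k) = #|[set j | len j == k]|.
Proof.
rewrite cardE /level enumT /enum_mem; congr size.
by apply: eq_filter => j; rewrite /= inE.
Qed.

Definition recolouring (f f' : 'I_n -> nat) : Prop :=
  exists p : {perm 'I_n}, forall j, len (p j) = len j /\ f' (p j) = f j.

(** The permutation is found on the lists of pairs ([len j], [f j]): a pair (k, v) occurs there as
    often as v occurs among the colours of [level k]. *)
Lemma recolouringP f f' : recolouring f f' <->
  forall k, perm_eq [seq f j | j <- level k] [seq f' j | j <- level k].
Proof.
split=> [[p hp] k|h].
  have -> : [seq f j | j <- level k] = [seq f' j | j <- [seq p j | j <- level k]].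
    by rewrite -map_comp; apply: eq_map => j /=; case: (hp j).
  apply/perm_map/uniq_perm; 
    rewrite ?(map_inj_uniq perm_inj) ?level_uniq //.
  move=> j; rewrite -[j](permKV p) (mem_map perm_inj) !mem_level.
  by case: (hp (p^-1%g j)) => ->.
have [|p hp] := @perm_eq_map_perm _ n
  (fun j => (len j, f j)) (fun j => (len j, f' j)).
  rewrite /perm_eq; apply/allP => -[k v] _ /=.
  rewrite [X in X == _]count_map [X in _ == X]count_map.
  have E (u : 'I_n -> nat) :
      count (preim (fun j => (len j, u j)) (pred1 (k, v))) (enum 'I_n)
      = count (pred1 v) [seq u j | j <- level k].
    rewrite [RHS]count_map /level count_filter; apply: eq_count => j /=.
    by rewrite xpair_eqE andbC.
  by rewrite !E (seq.permP (h k)).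
by exists p => j; case: (hp j) => -> ->.
Qed.

(** A multiset of colours is stored as its sorted tuple. The index k stands for the length [k.+1],
    and [(c k.+1).-1.+1] equals [c k.+1] by [c_gt0], in the successor form for which sorted tuples
    are counted. *)
Definition colour_list (k : 'I_N) : finType :=
  {t : (size (level k.+1)).-tuple 'I_(c k.+1).-1.+1 | sorted leq (map val t)}.

Definition normal_form : finType := {dffun forall k : 'I_N, colour_list k}.

Lemma card_normal_form :
  #|normal_form| = \prod_(1 <= k < N.+1)
    'C(c k + #|[set j | len j == k]| - 1, #|[set j | len j == k]|).
Proof.
rewrite card_dep_ffun foldrE big_map big_enum big_add1 big_mkord /=.
apply: eq_bigr => k _; rewrite -size_level /colour_list card_sig.
have := card_sorted_tuples (size (level k.+1)) (c k.+1).-1.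
rewrite cardsE => ->; have := c_gt0 (ltn_ord k : 0 < k.+1 <= N).
by case: (c _) => // m _; rewrite addSn subn1 /= addnC.
Qed.

Definition colours (t : normal_form) (k : 'I_N) : seq nat :=
  [seq nat_of_ord i | i <- val (t k)].

Lemma len_pred_lt j : (len j).-1 < N.
Proof. by have /andP[] := len_range j; case: (len j). Qed.

(** Elements of a level receive the entries of its sorted list in order; the default 0 is never
    reached. *)
Definition colour_of (t : normal_form) (j : 'I_n) : nat :=
  nth 0 (colours t (Ordinal (len_pred_lt j))) (index j (level (len j))).

Lemma map_colour_of t (k : 'I_N) :
  [seq colour_of t j | j <- level k.+1] = colours t k.
Proof.
rewrite -[RHS](@map_nth_index _ _ 0 (level k.+1)) ?level_uniq //; last first.
  by rewrite size_map size_tuple.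
apply/eq_in_map => j; rewrite mem_level => /eqP lj.
have jk : Ordinal (len_pred_lt j) = k by apply: val_inj; rewrite /= lj.
by rewrite /colour_of jk lj.
Qed.

Lemma colour_of_lt t j : colour_of t j < c (len j).
Proof.
have jl : len j = (Ordinal (len_pred_lt j)).+1.
  by rewrite /=; have /andP[] := len_range j; case: (len j).
have : colour_of t j \in colours t (Ordinal (len_pred_lt j)).
  by rewrite -map_colour_of map_f // mem_level -jl.
move=> /mapP[i _ ->]; rewrite {2}jl; apply: leq_trans (ltn_ord i) _.
by rewrite prednK // -jl c_gt0 // len_range.
Qed.

(** A sorted list is determined by its multiset of entries, which [recolouringP] recovers. *)
Lemma colour_of_inj t t' : recolouring (colour_of t) (colour_of t') -> t = t'.
Proof.
move=> /recolouringP h; apply/ffunP => k; apply/val_inj/val_inj.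
apply: (inj_map val_inj); apply: (sorted_eq leq_trans anti_leq).
- exact: (valP (t k)).
- exact: (valP (t' k)).
by have := h k.+1; rewrite !map_colour_of.
Qed.

Lemma colour_of_surj (f : 'I_n -> nat) : (forall j, f j < c (len j)) ->
  exists t, recolouring f (colour_of t).
Proof.
move=> fc.
pose s (k : 'I_N) : seq 'I_(c k.+1).-1.+1 :=
  sort (fun x y : 'I__ => x <= y) [seq inord (f j) | j <- level k.+1].
have s_size k : size (s k) == size (level k.+1) by rewrite size_sort size_map.
have s_sorted k : sorted leq (map val (Tuple (s_size k))).
  rewrite /= sorted_map; apply: sort_sorted => x y; exact: leq_total.
exists [ffun k => exist _ (Tuple (s_size k)) (s_sorted k) : colour_list k].
(* A level whose index is no [len j] is empty; any other index is a successor [k.+1] with k below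
   N. *)
apply/recolouringP => k; have [j lj|none] := pickP (fun j => len j == k); last first.
  have -> // : level k = [::].
  by apply/eqP; rewrite -[_ == _]negbK -has_filter; apply/hasPn => j _; rewrite none.
have kk : k = (Ordinal (len_pred_lt j)).+1.
  by rewrite /= -(eqP lj); have /andP[] := len_range j; case: (len j).
rewrite kk; move: (Ordinal _) => {j lj kk}k.
rewrite map_colour_of /colours ffunE /= perm_sym.
apply: perm_trans (perm_map _ (permEl (perm_sort _ _))) _.
rewrite -map_comp.
have -> // : [seq nat_of_ord (inord (f j) : 'I_(c k.+1).-1.+1) | j <- level k.+1]
  = [seq f j | j <- level k.+1].
apply/eq_in_map => j; rewrite mem_level => /eqP lj.
by rewrite /= inordK // -lj prednK // c_gt0.
Qed.

Lemma exists_colouring_reps d :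
  d = \prod_(1 <= k < N.+1)
    'C(c k + #|[set j | len j == k]| - 1, #|[set j | len j == k]|) ->
  exists a : 'I_d -> 'I_n -> nat,
  [/\ forall i j, a i j < c (len j),
      forall i i', recolouring (a i) (a i') -> i = i'
    & forall f, (forall j, f j < c (len j)) -> exists i, recolouring f (a i)].
Proof.
rewrite -card_normal_form => ->.
exists (fun i => colour_of (enum_val i)); split=> [i j|i i'|f fc].
- exact: colour_of_lt.
- by move=> /colour_of_inj /enum_val_inj.
by have [t ht] := colour_of_surj fc; exists (enum_rank t); rewrite enum_rankK.
Qed.

End Colourings.

Local Open Scope ring_scope.

(** * Symplectic form and image of 1 - phi *)

Lemma pair_eq (T1 T2 : Type) (p q : T1 * T2) : p.1 = q.1 -> p.2 = q.2 -> p = q.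
Proof. by case: p => a b; case: q => c d /= -> ->. Qed.

Lemma zaddE N (u v : Z2N N) : zadd u v = u + v.
Proof. by apply/ffunP => i; rewrite !ffunE. Qed.

Lemma zsubE N (u v : Z2N N) : zsub u v = u - v.
Proof. by apply/ffunP => i; rewrite !ffunE. Qed.

Lemma zscaleE N n (u : Z2N N) : zscale n u = u *+ n.
Proof.
apply/ffunP => i; rewrite ffunE ffunMnE.
by elim: n => [|n IH]; rewrite ?mulr0n // !mulrSr -IH.
Qed.

Lemma gact_is_zmod_morphism (g : 'M[int]_2) : zmod_morphism (gact g).
Proof. by move=> p q; apply: pair_eq => /=; ring. Qed.
HB.instance Definition _ (g : 'M[int]_2) :=
  GRing.isZmodMorphism.Build _ _ (gact g) (gact_is_zmod_morphism g).

Lemma wgact_is_zmod_morphism N (s : {perm 'I_N}) (g : 'M[int]_2) :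
  zmod_morphism (wgact s g).
Proof. by move=> u v; apply/ffunP => i; rewrite !ffunE raddfB. Qed.
HB.instance Definition _ N (s : {perm 'I_N}) (g : 'M[int]_2) :=
  GRing.isZmodMorphism.Build _ _ (wgact s g) (wgact_is_zmod_morphism s g).

Lemma pact_is_zmod_morphism N (s : {perm 'I_N}) : zmod_morphism (pact s).
Proof. by move=> u v; apply/ffunP => i; rewrite !ffunE. Qed.
HB.instance Definition _ N (s : {perm 'I_N}) :=
  GRing.isZmodMorphism.Build _ _ (pact s) (pact_is_zmod_morphism s).

Lemma wgactD N (w : {perm 'I_N}) g (u v : Z2N N) :
  wgact w g (u + v) = wgact w g u + wgact w g v.
Proof. exact: raddfD. Qed.

Lemma wgactB N (w : {perm 'I_N}) g (u v : Z2N N) :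
  wgact w g (u - v) = wgact w g u - wgact w g v.
Proof. exact: raddfB. Qed.

Lemma wgactMn N (w : {perm 'I_N}) g (u : Z2N N) n :
  wgact w g (u *+ n) = wgact w g u *+ n.
Proof. exact: raddfMn. Qed.

Lemma pactB N (s : {perm 'I_N}) (u v : Z2N N) :
  pact s (u - v) = pact s u - pact s v.
Proof. exact: raddfB. Qed.

Lemma pactMn N (s : {perm 'I_N}) (u : Z2N N) n :
  pact s (u *+ n) = pact s u *+ n.
Proof. exact: raddfMn. Qed.

Lemma pact1 N (u : Z2N N) : pact 1%g u = u.
Proof. by apply/ffunP => i; rewrite ffunE invg1 perm1. Qed.

Lemma pactM N (s t : {perm 'I_N}) (u : Z2N N) :
  pact (s * t)%g u = pact t (pact s u).
Proof. by apply/ffunP => i; rewrite !ffunE invMg permM. Qed.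

Lemma pact_wgact N (s w : {perm 'I_N}) g (u : Z2N N) : commute s w ->
  pact s (wgact w g u) = wgact w g (pact s u).
Proof.
move=> sw; apply/ffunP => i; rewrite !ffunE -!permM.
by rewrite -!invMg sw.
Qed.

Definition area (p q : int * int) : int := p.1 * q.2 - p.2 * q.1.

Lemma omegaE N (u v : Z2N N) : omega u v = \sum_i area (u i) (v i).
Proof. by []. Qed.

Lemma omegaDl N (u u' v : Z2N N) : omega (u + u') v = omega u v + omega u' v.
Proof.
rewrite !omegaE -big_split; apply: eq_bigr => i _.
by rewrite ffunE /area /=; ring.
Qed.

Lemma omegaNC N (u v : Z2N N) : omega u v = - omega v u.
Proof.
by rewrite !omegaE -sumrN; apply: eq_bigr => i _; rewrite /area; ring.
Qed.

Lemma omegaDr N (u v v' : Z2N N) : omega u (v + v') = omega u v + omega u v'.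
Proof. by rewrite omegaNC omegaDl opprD -!omegaNC. Qed.

Lemma omegaNl N (u v : Z2N N) : omega (- u) v = - omega u v.
Proof.
rewrite !omegaE -sumrN; apply: eq_bigr => i _.
by rewrite ffunE /area /=; ring.
Qed.

Lemma omegaNr N (u v : Z2N N) : omega u (- v) = - omega u v.
Proof. by rewrite omegaNC omegaNl -omegaNC. Qed.

Definition omegaD := (omegaDl, omegaDr, omegaNl, omegaNr).

Lemma omegauu N (u : Z2N N) : omega u u = 0.
Proof. by rewrite omegaE big1 // => i _; rewrite /area; ring. Qed.

Lemma omegaMnl N (u v : Z2N N) n : omega (u *+ n) v = n%:R * omega u v.
Proof.
elim: n => [|n IH].
  by rewrite mulr0n mul0r omegaE big1 // => i _; rewrite ffunE /area; ring.
by rewrite mulrSr omegaDl IH -natr1 mulrDl mul1r.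
Qed.

Lemma omegaMnr N (u v : Z2N N) n : omega u (v *+ n) = n%:R * omega u v.
Proof. by rewrite omegaNC omegaMnl -mulrN -omegaNC. Qed.

Lemma det2 (R : comPzRingType) (A : 'M[R]_2) :
  \det A = A 0 0 * A 1 1 - A 0 1 * A 1 0.
Proof.
rewrite (expand_det_row _ 0) !big_ord_recl big_ord0 /cofactor !det_mx11 !mxE /=.
have -> : lift 0 0 = 1 :> 'I_2 by apply: val_inj.
have -> : lift 1 0 = 0 :> 'I_2 by apply: val_inj.
by rewrite /= expr0 expr1; ring.
Qed.

Lemma area_gact (g : 'M[int]_2) p q : \det g = 1 ->
  area (gact g p) (gact g q) = area p q.
Proof.
move=> g1; rewrite -[RHS]mul1r -g1 det2 /area /=.
by ring.
Qed.

Lemma omega_pact N (s : {perm 'I_N}) (u v : Z2N N) :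
  omega (pact s u) (pact s v) = omega u v.
Proof.
rewrite !omegaE [RHS](reindex_inj (@perm_inj _ s^-1%g)) /=.
by apply: eq_bigr => i _; rewrite !ffunE.
Qed.

Lemma omega_wgact N (s : {perm 'I_N}) g (u v : Z2N N) : \det g = 1 ->
  omega (wgact s g u) (wgact s g v) = omega u v.
Proof.
move=> g1; rewrite -(omega_pact s u) !omegaE.
by apply: eq_bigr => i _; rewrite !ffunE area_gact.
Qed.

Lemma omega_nondeg N (u : Z2N N) : (forall v, omega u v = 0) -> u = 0.
Proof.
move=> u0; apply/ffunP => i.
have single p : omega u [ffun j => if j == i then p else 0] = area (u i) p.
  rewrite omegaE (bigD1 i) //= big1 ?addr0 ?ffunE ?eqxx // => j /negPf ji.
  by rewrite ffunE ji /area /=; ring.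
have := u0 [ffun j => if j == i then (0, 1) else 0].
have := u0 [ffun j => if j == i then (1, 0) else 0].
rewrite !single /area /= !mulr0 !mulr1 sub0r subr0 ffunE.
by move=> /eqP; rewrite oppr_eq0 => /eqP ? ?; apply: pair_eq.
Qed.

(** Counterparts of [in_imM], [is_tors] and [same_orbit] for any permutation, so that the same
    lemmas serve w and each of its cycles. *)
Definition in_im N (w : {perm 'I_N}) g (x : Z2N N) : Prop :=
  exists y : Z2N N, x = y - wgact w g y.

Definition torsion N (w : {perm 'I_N}) g (x : Z2N N) : Prop :=
  exists n : nat, (0 < n)%N /\ in_im w g (x *+ n).

Definition orbit_eq N (w : {perm 'I_N}) g (x y : Z2N N) : Prop :=
  exists2 s : {perm 'I_N}, s \in 'C[w]%g & in_im w g (pact s x - y).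

Section Image.
Variables (N : nat) (w : {perm 'I_N}) (g : 'M[int]_2).
Implicit Types x y z : Z2N N.

Lemma in_im0 : in_im w g 0.
Proof. by exists 0; rewrite raddf0 subr0. Qed.

Lemma in_imD x y : in_im w g x -> in_im w g y -> in_im w g (x + y).
Proof.
by move=> [a ->] [b ->]; exists (a + b); rewrite raddfD opprD addrACA.
Qed.

Lemma in_imN x : in_im w g x -> in_im w g (- x).
Proof. by move=> [a ->]; exists (- a); rewrite raddfN opprB opprK addrC. Qed.

Lemma in_imB x y : in_im w g x -> in_im w g y -> in_im w g (x - y).
Proof. by move=> hx /in_imN; apply: in_imD. Qed.

Lemma in_imMn x n : in_im w g x -> in_im w g (x *+ n).
Proof.
move=> hx; elim: n => [|n IH]; first exact: in_im0.
by rewrite mulrSr; apply: in_imD.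
Qed.

Lemma in_im_pact s x : s \in 'C[w]%g -> in_im w g x -> in_im w g (pact s x).
Proof.
move=> /cent1P sw [a ->]; exists (pact s a).
by rewrite pactB pact_wgact.
Qed.

Lemma orbit_eq_refl x : orbit_eq w g x x.
Proof. by exists 1%g; rewrite ?group1 // pact1 subrr; apply: in_im0. Qed.

Lemma orbit_eq_sym x y : orbit_eq w g x y -> orbit_eq w g y x.
Proof.
move=> [s sw h]; exists s^-1%g; first by rewrite groupV.
have := in_imN (in_im_pact (groupVr sw) h).
by rewrite pactB opprB -pactM mulgV pact1.
Qed.

Lemma orbit_eq_trans y x z :
  orbit_eq w g x y -> orbit_eq w g y z -> orbit_eq w g x z.
Proof.
move=> [s sw h] [s' sw' h']; exists (s * s')%g; first exact: groupM.
have := in_imD (in_im_pact sw' h) h'.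
by rewrite pactB addrA subrK pactM.
Qed.

Lemma in_im_orbit_eq x y : in_im w g (x - y) -> orbit_eq w g x y.
Proof. by move=> h; exists 1%g; rewrite ?group1 // pact1. Qed.

Lemma torsion_im x y : in_im w g (x - y) -> torsion w g x -> torsion w g y.
Proof.
move=> h [n [n0 hx]]; exists n; split=> //.
have -> : y *+ n = x *+ n - (x - y) *+ n.
  by rewrite -mulrnBl opprB addrC subrK.
by apply: in_imB => //; apply: in_imMn.
Qed.

Lemma torsion_pact s x : s \in 'C[w]%g -> torsion w g x -> torsion w g (pact s x).
Proof.
move=> sw [n [n0 hx]]; exists n; split=> //.
by rewrite -pactMn; apply: in_im_pact.
Qed.

Lemma orbit_eq_torsion x y : orbit_eq w g x y -> torsion w g x -> torsion w g y.
Proof. by move=> [s sw h] /(torsion_pact sw); apply: torsion_im. Qed.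

End Image.

(** * Torsion versus fixed vectors *)

Lemma clear_denominators m n (A : 'M[rat]_(m, n)) :
  exists (k : nat) (B : 'M[int]_(m, n)), (0 < k)%N /\ A *+ k = map_mx intr B.
Proof.
pose d (p : 'I_m * 'I_n) := `|denq (A p.1 p.2)|%N.
exists (\prod_p d p)%N.
exists (\matrix_(i, j) (numq (A i j) * (\prod_(p | p != (i, j)) d p)%N%:Z)).
split; first by rewrite prodn_gt0 // => p; rewrite absz_gt0 denq_eq0.
apply/matrixP => i j; rewrite mulmxnE !mxE (bigD1 (i, j)) //=.
rewrite -(mulr_natr (A i j)) natrM mulrA rmorphM /= -pmulrn; congr (_ * _).
rewrite /d /= natr_absz gtr0_norm ?denq_gt0 //.
by rewrite -{1}(divq_num_den (A i j)) divfK // intr_eq0 denq_eq0.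
Qed.

(** Over the rationals x lies in the row space of M or is detected by a column of the cokernel
    matrix. Clearing denominators in the coefficients, respectively in that column, returns to the
    integers. *)
Lemma saturated_or_separated m n (M : 'M[int]_(m, n)) (x : 'rV[int]_n) :
  (exists (k : nat) (y : 'rV[int]_m), (0 < k)%N /\ x *+ k = y *m M) \/
  (exists z : 'cV[int]_n, M *m z = 0 /\ (x *m z) 0 0 != 0).
Proof.
pose toQ a b (A : 'M[int]_(a, b)) : 'M[rat]_(a, b) := map_mx intr A.
have toQ_inj a b : injective (toQ a b).
  move=> A B /matrixP AB; apply/matrixP => i j.
  by have := AB i j; rewrite !mxE => /intr_inj.
have [/submxP [y xy]|nsub] := boolP (toQ _ _ x <= toQ _ _ M)%MS; [left|right].
  have [k [y' [k0 yk]]] := clear_denominators y.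
  exists k, y'; split=> //; apply: toQ_inj.
  rewrite /toQ map_mxM -yk raddfMn /= -/(toQ _ _ _) xy.
  by rewrite -!scaler_nat scalemxAl.
rewrite submxE in nsub; move/eqP: nsub => h.
have [j hj] : exists j, (toQ _ _ x *m cokermx (toQ _ _ M)) 0 j != 0.
  apply: contrapT => nh; apply: h; apply/rowP => j; rewrite [RHS]mxE.
  by apply: contrapT => /eqP hj; apply: nh; exists j.
pose c := col j (cokermx (toQ _ _ M)).
have [k [z [k0 ck]]] := clear_denominators c.
exists z; split.
  apply: toQ_inj; rewrite /toQ map_mxM -ck map_mx0 -scaler_nat -scalemxAr.
  by rewrite /c colE mulmxA mulmx_coker mul0mx scaler0.
have : (toQ _ _ x *m (c *+ k)) 0 0 != 0.
  rewrite -scaler_nat -scalemxAr scaler_nat mulmxnE mulrn_eq0.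
  by rewrite negb_or -lt0n k0 /c colE mulmxA -colE mxE.
by rewrite ck /toQ -map_mxM mxE intr_eq0.
Qed.

Section FixedVectors.
Variables (N : nat) (w : {perm 'I_N}) (g : 'M[int]_2).

Definition coords (x : Z2N N) : 'rV[int]_(N + N) :=
  row_mx (\row_i (x i).1) (\row_i (x i).2).

Definition of_coords (r : 'rV[int]_(N + N)) : Z2N N :=
  [ffun i => (r 0 (lshift N i), r 0 (rshift N i))].

Lemma coordsK : cancel coords of_coords.
Proof.
move=> x; apply/ffunP=> i; rewrite ffunE /coords row_mxEl row_mxEr !mxE.
by case: (x i).
Qed.

Lemma of_coordsK : cancel of_coords coords.
Proof.
move=> r; apply/rowP=> i; rewrite -[i]splitK /unsplit.
by case: (split i) => j; rewrite /coords ?row_mxEl ?row_mxEr mxE ffunE.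
Qed.

Lemma of_coords_is_zmod_morphism : zmod_morphism of_coords.
Proof. by move=> a b; apply/ffunP=> i; rewrite !ffunE !mxE. Qed.
HB.instance Definition _ :=
  GRing.isZmodMorphism.Build _ _ of_coords of_coords_is_zmod_morphism.

Lemma coords_is_zmod_morphism : zmod_morphism coords.
Proof.
by move=> x y; apply: (can_inj of_coordsK); rewrite raddfB /= !coordsK.
Qed.
HB.instance Definition _ :=
  GRing.isZmodMorphism.Build _ _ coords coords_is_zmod_morphism.

Definition defect (r : 'rV[int]_(N + N)) : 'rV[int]_(N + N) :=
  coords (of_coords r - wgact w g (of_coords r)).

Lemma defect_is_zmod_morphism : zmod_morphism defect.
Proof.
move=> a b; rewrite /defect -raddfB; congr coords.
by rewrite !raddfB /= addrACA.
Qed.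
HB.instance Definition _ :=
  GRing.isZmodMorphism.Build _ _ defect defect_is_zmod_morphism.

Lemma wgact_surj (v : Z2N N) : \det g = 1 -> exists u, v = wgact w g u.
Proof.
rewrite det2 => g1.
(* The adjugate of g, which is its inverse as the determinant is 1, applied to the pair at [w i]. *)
exists [ffun i => (g 1 1 * (v (w i)).1 - g 0 1 * (v (w i)).2,
                   - g 1 0 * (v (w i)).1 + g 0 0 * (v (w i)).2)].
apply/ffunP => i; rewrite !ffunE permKV /gact; case: (v i) => p q /=; congr (_, _).
  by rewrite -[LHS]mul1r -g1; ring.
by rewrite -[LHS]mul1r -g1; ring.
Qed.

(* The image of 1 - w (x) g lies in the omega-orthogonal of its kernel, and is
   of finite index there. *)
Lemma torsion_or_fixed (x : Z2N N) : \det g = 1 ->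
  torsion w g x \/ exists2 u, wgact w g u = u & omega u x != 0.
Proof.
move=> g1.
pose M := \matrix_i defect (delta_mx 0 i).
have LE r : r *m M = defect r.
  rewrite {2}(row_sum_delta r) raddf_sum mulmx_sum_row; apply: eq_bigr => i _.
  by rewrite rowK -[r 0 i]intz !scaler_int raddfMz.
have [[k [y [k0 hk]]]|[z [Mz xz]]] := saturated_or_separated M (coords x).
  left; exists k; split=> //; exists (of_coords y).
  apply: (can_inj coordsK); rewrite -/(defect y) -LE -hk.
  exact: raddfMn.
right.
(* u represents z through omega: omega(u, v) is [coords v] times z. *)
pose u : Z2N N := [ffun i => (z (rshift N i) 0, - z (lshift N i) 0)].
have omu v : omega u v = (coords v *m z) 0 0.
  rewrite omegaE mxE big_split_ord /= -big_split; apply: eq_bigr => i _.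
  by rewrite /coords row_mxEl row_mxEr !mxE ffunE /area /=; ring.
exists u; last by rewrite omu.
(* Since z kills the image of 1 - phi, omega(phi u - u, phi v') = omega(u, v' - phi v') = 0, and
   every v is some phi v'. *)
apply/eqP; rewrite -subr_eq0; apply/eqP; apply: omega_nondeg => v.
have [v' ->] := wgact_surj v g1.
rewrite omegaDl omegaNl omega_wgact // -omegaNr -omegaDr omu.
have := LE (coords v'); rewrite /defect coordsK => <-.
by rewrite -mulmxA Mz mulmx0 mxE.
Qed.
End FixedVectors.

(** * Twisted Hochschild homology *)

Lemma tq_neq0 : tq != 0.
Proof. by rewrite tofrac_eq0 polyX_eq0. Qed.

Lemma tq_expn_eq1 n : tq ^+ n = 1 -> n = 0%N.
Proof.
rewrite -tofracXn -tofrac1 => /eqP; rewrite tofrac_eq => /eqP h.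
have := congr1 (fun p : {poly CC} => size p) h.
by rewrite size_polyXn size_poly1 => -[].
Qed.

Lemma tq_exp_eq1 (a : int) : tq ^ a = 1 -> a = 0.
Proof.
case: a => n; first by rewrite -exprnP => /tq_expn_eq1 ->.
by rewrite NegzE -exprnN => /(congr1 GRing.inv); rewrite invrK invr1 => /tq_expn_eq1.
Qed.

(** As t is not a root of unity, differences of distinct powers are invertible; this is what kills
    the non-torsion classes. *)
Lemma tq_exp_inj : injective (fun a : int => tq ^ a).
Proof.
move=> a b /= ab; apply/eqP; rewrite -subr_eq0; apply/eqP/tq_exp_eq1.
by rewrite expfzDr ?tq_neq0 // ab -expfzDr ?tq_neq0 // subrr expr0z.
Qed.

(** * Formal sums and linear functionals *)

Lemma coef_nil N (x : Z2N N) : coef [::] x = 0.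
Proof. by rewrite /coef big_nil. Qed.

Lemma coef_cons N a v (e : elt N) (x : Z2N N) :
  coef ((a, v) :: e) x = a * (x == v)%:R + coef e x.
Proof.
by rewrite /coef big_cons /= eq_sym; case: eqP; rewrite ?mulr1 ?mulr0.
Qed.

Lemma coef_cat N (e e' : elt N) (x : Z2N N) :
  coef (e ++ e') x = coef e x + coef e' x.
Proof. by rewrite /coef big_cat. Qed.

Definition escale N (a : K) (e : elt N) : elt N := [seq (a * p.1, p.2) | p <- e].

Lemma coef_escale N a (e : elt N) (x : Z2N N) : coef (escale a e) x = a * coef e x.
Proof.
rewrite /coef /escale big_map mulr_sumr; apply: eq_bigr => p _ /=.
by case: eqP; rewrite ?mulr0.
Qed.

(** The linear functional on A_N with values F on the basis, computed on a formal sum. *)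
Definition eval N (F : Z2N N -> K) (e : elt N) : K := \sum_(p <- e) p.1 * F p.2.

Lemma eval_cat N (F : Z2N N -> K) e e' : eval F (e ++ e') = eval F e + eval F e'.
Proof. by rewrite /eval big_cat. Qed.

Lemma eval_escale N (F : Z2N N -> K) a e : eval F (escale a e) = a * eval F e.
Proof.
by rewrite /eval big_map mulr_sumr; apply: eq_bigr => p _; rewrite mulrA.
Qed.

Definition lincomb N (I : Type) (s : seq I) (a : I -> K) (e : I -> elt N) : elt N :=
  flatten [seq escale (a i) (e i) | i <- s].

Lemma coef_lincomb N (I : Type) (s : seq I) a (e : I -> elt N) (x : Z2N N) :
  coef (lincomb s a e) x = \sum_(i <- s) a i * coef (e i) x.
Proof.
elim: s => [|i s IH]; first by rewrite coef_nil big_nil.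
by rewrite big_cons /lincomb /= coef_cat -/(lincomb s a e) IH coef_escale.
Qed.

Lemma eval_lincomb N (I : Type) (s : seq I) a (e : I -> elt N) F :
  eval F (lincomb s a e) = \sum_(i <- s) a i * eval F (e i).
Proof.
elim: s => [|i s IH]; first by rewrite /eval !big_nil.
by rewrite big_cons /lincomb /= eval_cat -/(lincomb s a e) IH eval_escale.
Qed.

Lemma eval_coef N (F : Z2N N -> K) (e : elt N) (s : seq (Z2N N)) :
  uniq s -> {subset [seq p.2 | p <- e] <= s} ->
  eval F e = \sum_(x <- s) coef e x * F x.
Proof.
move=> us; elim: e => [|[a v] e IH] es.
  by rewrite /eval big_nil big1 // => x _; rewrite coef_nil mul0r.
rewrite /eval big_cons /= -/(eval F e) IH; last first.
  by move=> x xe; apply: es; rewrite /= inE xe orbT.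
transitivity (\sum_(x <- s) (a * (x == v)%:R * F x + coef e x * F x)); last first.
  by apply: eq_bigr => x _; rewrite coef_cons mulrDl.
rewrite big_split /=; congr (_ + _).
rewrite (bigD1_seq v) //=; last by apply: es; rewrite inE eqxx.
rewrite eqxx mulr1 big1 ?addr0 // => x /negPf ->.
by rewrite mulr0 mul0r.
Qed.

(** Several formal sums represent one element of A_N; this makes [eval F] well defined on A_N. *)
Lemma eq_eval N (F : Z2N N -> K) (e e' : elt N) :
  coef e =1 coef e' -> eval F e = eval F e'.
Proof.
move=> ee'; pose s := undup [seq p.2 | p <- e ++ e'].
have us : uniq s by apply: undup_uniq.
rewrite !(@eval_coef _ F _ s) //; first by apply: eq_bigr => x _; rewrite ee'.
  by move=> x xe; rewrite mem_undup map_cat mem_cat xe orbT.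
by move=> x xe; rewrite mem_undup map_cat mem_cat xe.
Qed.

Section HochschildQuotient.
Variables (N : nat) (w : {perm 'I_N}) (g : 'M[int]_2).
Hypothesis g1 : \det g = 1.
Implicit Types x y z u v : Z2N N.
Local Notation phi := (wgact w g).

Lemma eq_in_W f f' : f =1 f' -> in_W w g f -> in_W w g f'.
Proof. by move=> /funext ->. Qed.

Lemma in_WD f f' : in_W w g f -> in_W w g f' -> in_W w g (fun x => f x + f' x).
Proof.
move=> [l1 [l2 [h2 hf]]] [l1' [l2' [h2' hf']]].
exists (l1 ++ l1'), (l2 ++ l2'); split.
  by move=> p; rewrite mem_cat => /orP[/h2|/h2'].
by move=> x; rewrite hf hf' !big_cat /= addrACA.
Qed.

Lemma in_WZ a f : in_W w g f -> in_W w g (fun x => a * f x).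
Proof.
move=> [l1 [l2 [h2 hf]]].
exists [seq (a * p.1, p.2) | p <- l1], [seq (a * p.1, p.2) | p <- l2]; split.
  by move=> _ /mapP[p pl2 ->]; exact: (h2 p pl2).
move=> x; rewrite hf !big_map mulrDr !mulr_sumr.
by congr (_ + _); apply: eq_bigr => p _; rewrite mulrA.
Qed.

Lemma in_W_hh u v : in_W w g (fun x =>
  tq ^ omega u v * (x == u + v)%:R - tq ^ omega v (phi u) * (x == v + phi u)%:R).
Proof.
exists [:: (1, (u, v))], [::]; split=> // x.
by rewrite big_seq1 big_nil addr0 mul1r /hh_rel !coef_cons coef_nil !zaddE
  addr0 mulNr.
Qed.

Lemma in_W_coinv s u : s \in 'C[w]%g ->
  in_W w g (fun x => (x == pact s u)%:R - (x == u)%:R).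
Proof.
move=> sw; exists [::], [:: (1, (s, u))]; split.
  by move=> p; rewrite inE => /eqP ->.
move=> x; rewrite big_seq1 big_nil add0r mul1r /coinv_rel !coef_cons coef_nil.
by rewrite addr0 mul1r mulN1r.
Qed.

Definition proportional u v :=
  exists a : K, in_W w g (fun x => (x == u)%:R - a * (x == v)%:R).

Lemma proportional_trans v u z :
  proportional u v -> proportional v z -> proportional u z.
Proof.
move=> [a ha] [b hb]; exists (a * b).
by apply: eq_in_W (in_WD ha (in_WZ a hb)) => x; ring.
Qed.

Lemma proportional_im u y : proportional u (u - (y - phi y)).
Proof.
(* The relation for y and u - y involves m_u and m_(u - (y - phi y)); dividing by the first
   coefficient isolates m_u. *)
have := in_WZ (tq ^ omega y (u - y))^-1 (in_W_hh y (u - y)).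
exists ((tq ^ omega y (u - y))^-1 * tq ^ omega (u - y) (phi y)).
apply: eq_in_W H => x.
rewrite mulrBr !mulrA mulVf ?expfz_neq0 ?tq_neq0 // mul1r.
by rewrite [y + _]addrC subrK opprB addrA addrAC.
Qed.

Lemma proportional_pact s u : s \in 'C[w]%g -> proportional u (pact s u).
Proof.
move=> sw; exists 1; apply: eq_in_W (in_WZ (-1) (in_W_coinv u sw)) => x.
by ring.
Qed.

Lemma orbit_eq_proportional u v : orbit_eq w g u v -> proportional u v.
Proof.
move=> [s sw [y hy]]; apply: proportional_trans (proportional_pact u sw) _.
have -> : v = pact s u - (y - phi y) by rewrite -hy opprB addrC subrK.
exact: proportional_im.
Qed.

(** For k fixed by phi, the relation for k and x - k reads (t^a - t^(-a)) m_x with a = omega(k, x).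
    Off the torsion some such k has a nonzero, and the coefficient is invertible. *)
Lemma in_W_nontorsion x : ~ torsion w g x -> in_W w g (fun y => (y == x)%:R).
Proof.
move=> nt; have [//|[k kk kx]] := torsion_or_fixed w x g1.
have h := in_W_hh k (x - k); rewrite kk [k + _]addrC subrK in h.
pose c := tq ^ omega k (x - k) - tq ^ omega (x - k) k.
have c0 : c != 0.
  rewrite subr_eq0; apply: contra kx => /eqP/tq_exp_inj.
  rewrite [omega (x - k) k]omegaNC !omegaD omegauu subr0 => /eqP.
  by rewrite eq_sym eqNr.
apply: eq_in_W (in_WZ c^-1 h) => y.
by rewrite -mulrBl mulrA mulVf // mul1r.
Qed.

(** Invariance of omega gives omega(k, phi z) = omega(phi k, phi z) = - omega(z, k), so the cross
    terms cancel. *)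
Lemma omega_shift_fixed z k : phi k = k ->
  omega (z + k) (phi (z + k)) = omega z (phi z).
Proof.
move=> fk; have kz : omega k (phi z) = - omega z k.
  by rewrite -{1}fk omega_wgact // omegaNC.
by rewrite wgactD fk !omegaD kz omegauu; ring.
Qed.

(* For n x = y - phi y the number omega(y, phi y) / n^2 depends on x only. *)
Lemma exists_quadratic : exists Q : Z2N N -> rat,
  forall x y n, (0 < n)%N -> x *+ n = y - phi y ->
    Q x * n%:R ^+ 2 = (omega y (phi y))%:~R.
Proof.
suff /choice [Q hQ] : forall x, exists q : rat, forall y n, (0 < n)%N ->
    x *+ n = y - phi y -> q * n%:R ^+ 2 = (omega y (phi y))%:~R.
  by exists Q => x y n; apply: hQ.
move=> x; have [[n [n0 [y xy]]]|nt] := pselect (torsion w g x); last first.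
  by exists 0 => y n n0 xy; case: nt; exists n; split=> //; exists y.
exists ((omega y (phi y))%:~R / n%:R ^+ 2) => y' n' n'0 xy'.
(* Both multiples are preimages of (n n') x under 1 - phi, so they differ by a fixed vector. *)
pose k := y *+ n' - y' *+ n.
have fk : phi k = k.
  apply/esym/eqP; rewrite -subr_eq0; apply/eqP.
  have -> : k - phi k = (y - phi y) *+ n' - (y' - phi y') *+ n.
    by rewrite /k wgactB !wgactMn !mulrnBl !opprD !opprK addrACA.
  by rewrite -xy -xy' -!mulrnA mulnC subrr.
have : omega (y *+ n') (phi (y *+ n')) = omega (y' *+ n) (phi (y' *+ n)).
  have -> : y *+ n' = y' *+ n + k by rewrite /k addrC subrK.
  exact: omega_shift_fixed.
rewrite !wgactMn !omegaMnl !omegaMnr => /(congr1 (intr : int -> rat)).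
rewrite !rmorphM /= !rmorph_nat => e.
rewrite mulrAC; apply: (canLR (mulfK _)).
  by rewrite expf_neq0 // pnatr_eq0 -lt0n.
by rewrite mulrC expr2 -mulrA e; ring.
Qed.

(** Spanning: torsion basis vectors are proportional to a representative, and the others vanish.
    Independence: each orbit has a functional that vanishes on all relations, is 1 at its
    representative and 0 at the other ones. *)
Lemma hh_dim_of_orbit_reps d (rep : 'I_d -> Z2N N) :
  (forall i, torsion w g (rep i)) ->
  (forall i j, orbit_eq w g (rep i) (rep j) -> i = j) ->
  (forall x, torsion w g x -> exists i, orbit_eq w g x (rep i)) ->
  coinv_HH0_dim w g d.
Proof.
move=> rep_tors rep_inj rep_surj; exists (fun i => [:: (1, rep i)]); split.
  move=> u; have [ut|/in_W_nontorsion nt] := pselect (torsion w g u); last first.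
    exists (fun=> 0); apply: eq_in_W nt => x.
    by rewrite big1 ?subr0 // => i _; rewrite mul0r.
  have [i /orbit_eq_proportional [a ha]] := rep_surj u ut.
  exists (fun j => a * (j == i)%:R); apply: eq_in_W ha => x.
  rewrite (bigD1 i) //= big1 ?addr0; last first.
    by move=> j /negPf ->; rewrite mulr0 mul0r.
  by rewrite eqxx mulr1 coef_cons coef_nil addr0 mul1r.
move=> lam [l1 [l2 [l2w hl]]] i.
have [Q hQ] := exists_quadratic.
(* If n x = y - phi y, then y - n u is a preimage of n (x - u + phi u). The change of Q is exactly
   the exponent dictated by the Hochschild relation for u and x - u. *)
have Q_im x u : torsion w g x ->
    Q (x - u + phi u) - Q x = (omega u x - omega (x - u) (phi u))%:~R.
  move=> [n [n0 [y xy]]].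
  have n2 : n%:R ^+ 2 != 0 :> rat by rewrite expf_neq0 // pnatr_eq0 -lt0n.
  apply: (mulIf n2); rewrite mulrBl (hQ x y n) //.
  rewrite (hQ _ (y - u *+ n) n) //; last first.
    by rewrite wgactB wgactMn mulrnDl mulrnBl xy opprB addrA !(addrAC _ (- phi y)).
  have e1 : n%:R * omega u x = omega u y - omega u (phi y).
    by rewrite -omegaMnr xy !omegaD.
  have e2 : n%:R * omega x (phi u) = omega y (phi u) - omega y u.
    by rewrite -omegaMnl xy !omegaD omega_wgact.
  rewrite wgactB wgactMn -rmorphB -[n%:R in RHS](rmorph_nat intr).
  rewrite -rmorphXn -rmorphM /=.
  congr (intr _); transitivity (n%:R *
    (n%:R * omega u x - n%:R * omega x (phi u) + n%:R * omega u (phi u))).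
    by rewrite e1 e2 [omega u y]omegaNC !omegaD !omegaMnl !omegaMnr; ring.
  by rewrite !omegaD; ring.
have Q_pact x s : s \in 'C[w]%g -> torsion w g x -> Q (pact s x) = Q x.
  move=> sw [n [n0 [y xy]]].
  have csw : commute s w := elimT cent1P sw.
  have n2 : n%:R ^+ 2 != 0 :> rat by rewrite expf_neq0 // pnatr_eq0 -lt0n.
  apply: (mulIf n2); rewrite (hQ x y n) // (hQ _ (pact s y) n) //.
    by rewrite -pact_wgact // omega_pact.
  by rewrite -pactMn xy pactB pact_wgact.
pose r := rep i.
(* Q is only rational, but its differences along one orbit are integers, so normalising at r yields
   genuine powers of t. *)
have Q_int x : orbit_eq w g x r -> exists e : int, Q x - Q r = e%:~R.
  move=> xr; have xt := orbit_eq_torsion (orbit_eq_sym xr) (rep_tors i).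
  case: xr => s sw [y hy]; have := Q_im (pact s x) y (torsion_pact sw xt).
  have -> : pact s x - y + phi y = r.
    by rewrite -addrA [- y + _]addrC -(opprB y) -hy opprB addrC subrK.
  set e : int := (X in X%:~R) => he; exists (- e).
  by rewrite rmorphN /= -he opprB Q_pact.
pose F x := if `[< orbit_eq w g x r >] then tq ^ numq (Q x - Q r) else 0.
have F_hh u v : tq ^ omega u v * F (u + v) = tq ^ omega v (phi u) * F (v + phi u).
  have uv : orbit_eq w g (u + v) (v + phi u).
    apply: in_im_orbit_eq; exists u.
    by rewrite [u + v]addrC opprD addrACA subrr add0r.
  rewrite /F; case: asboolP => [xr|nxr]; last first.
    by rewrite asboolF ?mulr0 // => vr; apply: nxr; apply: orbit_eq_trans vr.
  rewrite asboolT; last exact: orbit_eq_trans (orbit_eq_sym uv) xr.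
  have [e he] := Q_int _ xr.
  have := Q_im _ u (orbit_eq_torsion (orbit_eq_sym xr) (rep_tors i)).
  rewrite [u + v - u]addrC addKr omegaDr omegauu add0r => he'.
  have -> : Q (v + phi u) - Q r = (omega u v - omega v (phi u) + e)%:~R.
    by rewrite rmorphD /= -he' -he addrA subrK.
  rewrite he !numq_int -!expfzDr ?tq_neq0 //.
  by rewrite addrA addrC [omega v _ + _]addrC subrK addrC.
have F_pact x s : s \in 'C[w]%g -> F (pact s x) = F x.
  move=> sw; have xs : orbit_eq w g x (pact s x).
    by exists s => //; rewrite subrr; apply: in_im0.
  rewrite /F; case: asboolP => [sxr|nsxr].
    have xr := orbit_eq_trans xs sxr; rewrite asboolT // Q_pact //.
    exact: orbit_eq_torsion (orbit_eq_sym xr) (rep_tors i).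
  rewrite asboolF // => xr; apply: nsxr.
  exact: orbit_eq_trans (orbit_eq_sym xs) xr.
(* [E1] is the given combination of representatives and [E2] its expression through relations; the
   functional F is [lam i] on the first and 0 on the second. *)
pose E1 := lincomb (enum 'I_d) lam (fun j => [:: (1, rep j)]).
pose E2 := lincomb l1 (fun p => p.1) (fun p => hh_rel w g p.2.1 p.2.2)
        ++ lincomb l2 (fun p => p.1) (fun p => coinv_rel p.2.1 p.2.2).
have : eval F E1 = eval F E2.
  apply: eq_eval => x; rewrite coef_cat !coef_lincomb -hl big_enum.
  by apply: eq_bigr.
rewrite eval_cat !eval_lincomb big_enum /= (bigD1 i) //= big1 ?addr0; last first.
  move=> j ji; rewrite /eval big_seq1 mul1r /F asboolF ?mulr0 //.
  by move=> /rep_inj jiE; rewrite jiE eqxx in ji.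
rewrite /eval big_seq1 mul1r {1}/F asboolT; last exact: orbit_eq_refl.
rewrite subrr -[0 : rat]/(0%:~R) numq_int expr0z mulr1 => ->.
rewrite big1 ?add0r => [|p _]; last first.
  by rewrite /hh_rel big_cons big_seq1 /= !zaddE F_hh mulNr subrr mulr0.
rewrite big_seq big1 // => p /l2w sw.
by rewrite /coinv_rel big_cons big_seq1 /= F_pact // mul1r mulN1r subrr mulr0.
Qed.

End HochschildQuotient.

(** * Restriction to the cycles of w *)

Section PermPowers.
Variables (T : finType) (w : {perm T}).

Lemma permX_porbit m x : (w ^+ (m %% #|porbit w x|))%g x = (w ^+ m)%g x.
Proof.
have fx : (w ^+ #|porbit w x|)%g x = x by rewrite permX iter_porbit.
rewrite [in RHS](divn_eq m #|porbit w x|) mulnC expgD permM expgM.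
by rewrite [X in _ = (_ X)]permX iter_fix.
Qed.

Lemma permX_porbit_inj m m' x : (m < #|porbit w x|)%N -> (m' < #|porbit w x|)%N ->
  (w ^+ m)%g x = (w ^+ m')%g x -> m = m'.
Proof.
move=> hm hm'; rewrite !permX -!(nth_traject w hm) -(nth_traject w hm') => /eqP.
by rewrite nth_uniq ?size_traject ?uniq_traject_porbit // => /eqP.
Qed.

End PermPowers.

(* Every i is w^(pos i) (base (idx i)) for exactly one chosen base point per
   cycle and exactly one exponent below the cycle length. *)
Record cycle_coords N (w : {perm 'I_N}) := CycleCoords {
  ncyc : nat;
  base : 'I_ncyc -> 'I_N;
  idx : 'I_N -> 'I_ncyc;
  pos : 'I_N -> nat;
  pos_lt : forall i, (pos i < #|porbit w (base (idx i))|)%N;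
  coordK : forall i, (w ^+ pos i)%g (base (idx i)) = i;
  idx_base : forall m j, idx ((w ^+ m)%g (base j)) = j }.

(** Choose a base point in each cycle and reduce exponents modulo its length. The choices live in
    [Prop], hence [inhabited]. *)
Lemma cycle_coords_exist N (w : {perm 'I_N}) : inhabited (cycle_coords w).
Proof.
have /choice [b hb] : forall j : 'I_#|porbits w|, exists x, porbit w x = enum_val j.
  by move=> j; have /imsetP [x _ ->] := enum_valP j; exists x.
have b_inj j j' : porbit w (b j) = porbit w (b j') -> j = j'.
  by rewrite !hb; apply: enum_val_inj.
have /choice [x hx] : forall i, exists j, porbit w (b j) = porbit w i.
  move=> i; have iw : porbit w i \in porbits w by apply: imset_f.
  by exists (enum_rank_in iw (porbit w i)); rewrite hb enum_rankK_in.
have /choice [p hp] : forall i, exists m,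
    (m < #|porbit w (b (x i))|)%N /\ (w ^+ m)%g (b (x i)) = i.
  move=> i; have : i \in porbit w (b (x i)) by rewrite hx porbit_id.
  move=> /porbitP [m im]; exists (m %% #|porbit w (b (x i))|)%N.
  by rewrite permX_porbit -im ltn_mod lt0n card_porbit_neq0.
constructor; apply: (@CycleCoords N w _ b x p) => [i|i|m j]; first by case: (hp i).
  by case: (hp i).
by apply: b_inj; rewrite hx porbit_perm.
Qed.

Lemma kcycleX_val k (m : 'I_k) r : val ((kcycle k ^+ r)%g m) = ((m + r) %% k)%N.
Proof.
elim: r => [|r IH]; first by rewrite expg0 perm1 addn0 modn_small.
by rewrite expgSr permM permE /= IH -addn1 modnDml addn1 addnS.
Qed.

(** By transitivity of the cycle, a permutation commuting with it is determined by the image of 0,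
    which is the exponent r. *)
Lemma kcycle_cent k (s : {perm 'I_k}) : s \in 'C[kcycle k]%g ->
  exists r, s = (kcycle k ^+ r)%g.
Proof.
case: k s => [|k] s sC; first by exists 0%N; apply/permP => -[].
exists (s ord0); apply/permP => m.
have -> : m = (kcycle k.+1 ^+ m)%g ord0.
  by apply: val_inj; rewrite kcycleX_val add0n modn_small.
have sm : commute s (kcycle k.+1 ^+ m)%g by apply/commuteX/cent1P.
rewrite -[LHS]permM -sm permM -[RHS]permM -expgD addnC expgD permM; congr (_ _).
by apply: val_inj; rewrite kcycleX_val add0n modn_small.
Qed.

Lemma in_imME k g (x : Z2N k) : in_imM g x <-> in_im (kcycle k) g x.
Proof.
split=> -[y hy]; exists y; last by move=> i; rewrite hy !ffunE.
by apply/ffunP => i; rewrite hy !ffunE.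
Qed.

Lemma is_torsE k g (x : Z2N k) : is_tors g x <-> torsion (kcycle k) g x.
Proof.
split=> -[n [n0 h]]; exists n; split=> //.
  by move/in_imME: h; rewrite zscaleE.
by apply/in_imME; rewrite zscaleE.
Qed.

Lemma same_orbitE k g (x y : Z2N k) : same_orbit g x y <-> orbit_eq (kcycle k) g x y.
Proof.
split=> [[r]|[s /kcycle_cent [r ->]] h]; last first.
  by exists r; rewrite zsubE; apply/in_imME.
rewrite zsubE => /in_imME h; exists (kcycle k ^+ r)%g => //.
by apply/cent1P; apply: commute_sym; apply: commuteX.
Qed.

Section Cycles.
Variables (N : nat) (w : {perm 'I_N}) (g : 'M[int]_2) (C : cycle_coords w).
Implicit Types (x y : Z2N N) (j : 'I_(ncyc C)).
Local Notation phi := (wgact w g).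

Definition clen j : nat := #|porbit w (base j)|.

Lemma clen_gt0 j : (0 < clen j)%N.
Proof. by rewrite lt0n card_porbit_neq0. Qed.

Lemma clen_range j : (0 < clen j <= N)%N.
Proof. by rewrite clen_gt0 -[leqRHS]card_ord max_card. Qed.

Lemma pos_base m j : pos C ((w ^+ m)%g (base j)) = (m %% clen j)%N.
Proof.
set i := (w ^+ m)%g (base j).
have ij : idx C i = j by apply: idx_base.
apply: (@permX_porbit_inj _ w _ _ (base j)).
- by rewrite -ij pos_lt.
- by rewrite ltn_mod clen_gt0.
by rewrite permX_porbit -/i -ij coordK.
Qed.

Lemma idx_w i : idx C (w i) = idx C i.
Proof. by rewrite -{1}(coordK C i) -permM -expgSr idx_base. Qed.

Lemma cyc_countE k : cyc_count w k = #|[set j | clen j == k]|.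
Proof.
have inj : {in [set j | clen j == k] &, injective (fun j => porbit w (base j))}.
  move=> j j' _ _ /= /eqP; rewrite eq_porbit_mem => /porbitP [m e].
  by rewrite -(idx_base (c := C) 0 j) expg0 perm1 e idx_base.
rewrite /cyc_count -(card_in_imset inj); apply: eq_card => c; rewrite inE.
apply/andP/imsetP => [[/imsetP [i _ ->] ck]|[j]].
  exists (idx C i); last by rewrite -{1}(coordK C i) porbit_perm.
  by rewrite inE /clen -(porbit_perm w (pos C i)) coordK.
by rewrite inE => ck ->; split=> //; apply: imset_f.
Qed.

(** Keeping k independent of j gives restrictions to distinct cycles of equal length the same type,
    without casts. *)
Definition res k x j : Z2N k := [ffun m : 'I_k => x ((w ^+ m)%g (base j))].

Lemma res_inj x y : (forall j, res (clen j) x j = res (clen j) y j) -> x = y.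
Proof.
move=> h; apply/ffunP => i; have /ffunP := h (idx C i).
by move=> /(_ (Ordinal (pos_lt C i))); rewrite !ffunE /= coordK.
Qed.

Lemma resB k x y j : res k (x - y) j = res k x j - res k y j.
Proof. by apply/ffunP => m; rewrite !ffunE. Qed.

Lemma resMn k x n j : res k (x *+ n) j = res k x j *+ n.
Proof. by apply/ffunP => m; rewrite !(ffunE, ffunMnE). Qed.

(** Commuting with w, s sends position q of cycle j to position q + r of cycle j', read modulo the
    length. *)
Lemma res_pact s r j j' x : s \in 'C[w]%g ->
  s (base j) = (w ^+ r)%g (base j') -> clen j' = clen j ->
  res (clen j) (pact s x) j' = pact (kcycle (clen j) ^+ r)%g (res (clen j) x j).
Proof.
move=> sw sj jj'; apply/ffunP => m; rewrite 3!ffunE.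
set m0 := ((kcycle (clen j) ^+ r)^-1)%g m.
have -> : m = (kcycle (clen j) ^+ r)%g m0 by rewrite permKV.
rewrite kcycleX_val ffunE; move: (nat_of_ord m0) => q; congr (x _).
rewrite -jj' permX_porbit addnC expgD permM -sj -permM.
have -> : (s * w ^+ q = w ^+ q * s)%g by apply/commuteX/cent1P.
by rewrite permM permK.
Qed.

Lemma res_wgact x j :
  res (clen j) (phi x) j = wgact (kcycle (clen j)) g (res (clen j) x j).
Proof.
have sw : w \in 'C[w]%g by apply/cent1P.
have wj : w (base j) = (w ^+ 1)%g (base j) by rewrite expg1.
have := @res_pact w 1 j j x sw wj erefl.
move=> /ffunP h; apply/ffunP => m.
by have := h m; rewrite expg1 !ffunE => ->.
Qed.

(** Blocks are functions of a natural position, so their type does not depend on the cycle; [extend]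
    turns a vector into such a function. *)
Definition glue (Y : 'I_(ncyc C) -> nat -> int * int) : Z2N N :=
  [ffun i => Y (idx C i) (pos C i)].

Lemma res_glue Y j : res (clen j) (glue Y) j = [ffun m : 'I_(clen j) => Y j m].
Proof.
by apply/ffunP => m; rewrite !ffunE idx_base pos_base modn_small.
Qed.

Definition extend k (z : Z2N k) (m : nat) : int * int :=
  if insub m is Some o then z o else 0.

Lemma extendE k (z : Z2N k) : [ffun m : 'I_k => extend z m] = z.
Proof. by apply/ffunP => m; rewrite ffunE /extend valK. Qed.

(** By [res_wgact] phi acts on each cycle separately, so preimages may be chosen cycle by cycle and
    glued. *)
Lemma in_im_res x :
  in_im w g x <-> forall j, in_im (kcycle (clen j)) g (res (clen j) x j).
Proof.
split=> [[y ->] j|h].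
  by exists (res (clen j) y j); rewrite resB res_wgact.
have /choice [Y hY] : forall j, exists Y : nat -> int * int, forall z : Z2N (clen j),
    z = [ffun m : 'I_(clen j) => Y m] ->
    res (clen j) x j = z - wgact (kcycle (clen j)) g z.
  by move=> j; have [z hz] := h j; exists (extend z) => _ ->; rewrite extendE.
exists (glue Y); apply: res_inj => j.
by rewrite resB res_wgact; apply: hY; rewrite res_glue.
Qed.

Lemma torsion_res x :
  torsion w g x <-> forall j, torsion (kcycle (clen j)) g (res (clen j) x j).
Proof.
split=> [[n [n0 /in_im_res h]] j|h].
  by exists n; split=> //; rewrite -resMn.
have [n hn] := choice h; exists (\prod_j n j)%N; split.
  by rewrite prodn_gt0 // => j; case: (hn j).
apply/in_im_res => j; rewrite resMn (bigD1 j) //= mulrnA.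
by apply: in_imMn; case: (hn j).
Qed.

(** This reflects the wreath product structure of C(w): its elements permute cycles of equal length
    and rotate each one, and any such data arise. *)
Lemma orbit_eq_res x y : orbit_eq w g x y <->
  exists p : {perm 'I_(ncyc C)}, forall j, clen (p j) = clen j /\
    orbit_eq (kcycle (clen j)) g (res (clen j) x j) (res (clen j) y (p j)).
Proof.
split=> [[s sw /in_im_res h]|[p hp]].
  pose f j := idx C (s (base j)).
  have sf j : s (base j) = (w ^+ pos C (s (base j)))%g (base (f j)).
    by rewrite coordK.
  have csw m : commute s (w ^+ m)%g by apply/commuteX/cent1P.
  (* If s sends two base points into one cycle, powers of w bring their images together; as s is
     injective and commutes with w, the base points share a cycle. *)
  have f_inj : injective f.
    move=> j j' fj; pose q := pos C (s (base j)); pose q' := pos C (s (base j')).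
    have e : (w ^+ q')%g (s (base j)) = (w ^+ q)%g (s (base j')).
      by rewrite (sf j) (sf j') fj -!permM -!expgD addnC.
    have : s ((w ^+ q')%g (base j)) = s ((w ^+ q)%g (base j')).
      by rewrite -!permM -!csw !permM.
    by move=> /perm_inj /(congr1 (idx C)); rewrite !idx_base.
  have lf j : clen (f j) = clen j.
    rewrite /clen -(porbit_perm w (pos C (s (base j)))) -sf.
    rewrite -[RHS](card_imset _ (@perm_inj _ s)); apply: eq_card => i.
    apply/porbitP/imsetP => [[m ->]|[_ /porbitP [m ->] ->]].
      by exists ((w ^+ m)%g (base j)); rewrite ?mem_porbit // -!permM csw.
    by exists m; rewrite -!permM csw.
  exists (perm f_inj) => j; rewrite permE lf; split=> //.
  apply/same_orbitE; exists (pos C (s (base j))); rewrite zsubE; apply/in_imME.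
  by rewrite -(res_pact x sw (sf j) (lf j)) -resB -(lf j); apply: h.
have lp j : clen (p j) = clen j by case: (hp j).
have /choice [r hr] : forall j, exists r, in_im (kcycle (clen j)) g
    (pact (kcycle (clen j) ^+ r)%g (res (clen j) x j) - res (clen j) y (p j)).
  move=> j; have [_ /same_orbitE [r]] := hp j; exists r.
  by apply/in_imME; rewrite -zsubE.
(* The candidate element of C(w) maps cycle j onto cycle [p j] with [base j] landing at position
   [r j], modulo the common length. *)
pose f i := (w ^+ (pos C i + r (idx C i)))%g (base (p (idx C i))).
have f_inj : injective f.
  move=> i i' ff; have ii' : idx C i = idx C i'.
    by have := congr1 (idx C) ff; rewrite !idx_base => /perm_inj.
  have := congr1 (pos C) ff; rewrite !pos_base -ii' lp => /eqP.
  rewrite eqn_modDr !modn_small ?pos_lt //; last by rewrite ii' pos_lt.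
  by move=> /eqP pp; rewrite -(coordK C i) -(coordK C i') pp ii'.
have fw i : f (w i) = w (f i).
  rewrite /f idx_w -[RHS]permM -expgSr.
  have -> : pos C (w i) = ((pos C i).+1 %% clen (idx C i))%N.
    by rewrite -{1}(coordK C i) -permM -expgSr pos_base.
  rewrite -(permX_porbit w _ (base _)) -/(clen _) lp modnDml -(lp (idx C i)).
  by rewrite permX_porbit.
have sw : perm f_inj \in 'C[w]%g.
  by apply/cent1P/permP => i; rewrite !permM !permE fw.
exists (perm f_inj) => //; apply/in_im_res => j.
rewrite -[j](permKV p); set j' := (p^-1%g j); rewrite lp resB.
rewrite (@res_pact _ (r j') j') //.
rewrite permE /f -[base j']perm1 -(expg0 w) idx_base pos_base mod0n.
by rewrite add0n.
Qed.

End Cycles.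

(** * Torsion orbits as colourings of the cycles *)

Lemma exists_torsion_reps (g : 'M[int]_2) (c : nat -> nat) N :
  (forall k, (0 < k <= N)%N -> orbit_count k g (c k)) ->
  exists rep : forall k, nat -> Z2N k, forall k, (0 < k <= N)%N ->
    [/\ forall i, (i < c k)%N -> torsion (kcycle k) g (rep k i),
        forall i j, (i < c k)%N -> (j < c k)%N ->
          orbit_eq (kcycle k) g (rep k i) (rep k j) -> i = j
      & forall x, torsion (kcycle k) g x ->
          exists2 i, (i < c k)%N & orbit_eq (kcycle k) g x (rep k i)].
Proof.
move=> hc.
have H k : exists r : nat -> Z2N k, (0 < k <= N)%N ->
    [/\ forall i, (i < c k)%N -> torsion (kcycle k) g (r i),
        forall i j, (i < c k)%N -> (j < c k)%N ->
          orbit_eq (kcycle k) g (r i) (r j) -> i = j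
      & forall x, torsion (kcycle k) g x ->
          exists2 i, (i < c k)%N & orbit_eq (kcycle k) g x (r i)].
  have [kN|kN] := boolP (0 < k <= N)%N; last by exists (fun=> 0).
  have [r [r_tors [r_inj r_surj]]] := hc k kN.
  (* Indexing by natural numbers, with default 0 from [c k] on, lets colours be plain numbers for
     all lengths at once. *)
  exists (fun i => if insub i is Some o then r o else 0) => _; split.
  - by move=> i ik; rewrite insubT /=; apply/is_torsE.
  - move=> i j ik jk; rewrite !insubT /= => /same_orbitE /r_inj.
    by move/(congr1 val).
  move=> x /is_torsE /r_surj [i /same_orbitE xi]; exists i => //.
  by rewrite valK.
exists (fun k => projT1 (cid (H k))) => k; exact: (projT2 (cid (H k))).
Qed.

Theorem theorem3p3 (N : nat) (g : 'M[int]_2) (w : {perm 'I_N}) (c : nat -> nat) :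
  \det g = 1 ->
  (forall k : nat, (1 <= k <= N)%N -> orbit_count k g (c k)) ->
  coinv_HH0_dim w g
    (\prod_(1 <= k < N.+1) 'C(c k + cyc_count w k - 1, cyc_count w k))%N.
Proof.
move=> g1 hc; have [C] := cycle_coords_exist w.
have [rep hrep] := exists_torsion_reps hc.
(* The zero vector is torsion, so there is at least one orbit. *)
have c_gt0 k : (0 < k <= N)%N -> (0 < c k)%N.
  move=> /hrep [_ _ /(_ 0) []]; last by move=> i ik _; apply: leq_ltn_trans ik.
  by exists 1%N; split=> //; rewrite mul0rn; apply: in_im0.
set d := (\prod_(1 <= k < N.+1) _)%N.
have [|a [a_lt a_inj a_surj]] := @exists_colouring_reps _ N (@clen _ _ C) c
    (@clen_range _ _ C) c_gt0 d.
  by apply: eq_bigr => k _; rewrite (cyc_countE C).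
(* The colour of a cycle is the index of the representative equivalent to the restriction of x. The
   separate k allows cycles j and [p j] of equal length to be compared. *)
pose has_type x (f : 'I_(ncyc C) -> nat) := forall k j, clen j = k ->
  orbit_eq (kcycle k) g (res k x j) (rep k (f j)).
pose point f := glue (fun j : 'I_(ncyc C) => extend (rep (clen j) (f j))).
have pointT f : has_type (point f) f.
  by move=> k j <-; rewrite res_glue extendE; apply: orbit_eq_refl.
have typed_torsion x f : (forall j, (f j < c (clen j))%N) -> has_type x f ->
    torsion w g x.
  move=> fc xf; apply/(torsion_res g C) => j; have [h _ _] := hrep _ (clen_range j).
  exact: orbit_eq_torsion (orbit_eq_sym (xf _ _ erefl)) (h _ (fc j)).
(* By [orbit_eq_res] equivalence means matching the cycles by a length-preserving permutation, and
   on each cycle equivalence means equal colours. *)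
have typed_orbit x y f f' : (forall j, (f j < c (clen j))%N) ->
    (forall j, (f' j < c (clen j))%N) -> has_type x f -> has_type y f' ->
    (orbit_eq w g x y <-> recolouring (@clen _ _ C) f f').
  move=> fc fc' xf yf'; rewrite (orbit_eq_res g C).
  split=> -[p hp]; exists p => j; have [lp h] := hp j; split=> //.
    have [_ inj _] := hrep _ (clen_range j).
    apply: inj; rewrite -?lp ?fc' // lp //.
    apply: orbit_eq_trans (xf _ _ erefl); apply: orbit_eq_sym.
    exact: orbit_eq_trans h (yf' _ _ lp).
  apply: orbit_eq_trans (xf _ _ erefl) _; rewrite -h.
  exact: orbit_eq_sym (yf' _ _ lp).
apply: (hh_dim_of_orbit_reps g1 (rep := fun i => point (a i))).
- by move=> i; apply: typed_torsion (a_lt i) (pointT _).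
- by move=> i i' /typed_orbit h; apply: a_inj; apply: h.
move=> x /(torsion_res g C) xt.
have /choice [f hf] : forall j : 'I_(ncyc C), exists i : nat, (i < c (clen j))%N /\
    orbit_eq (kcycle (clen j)) g (res (clen j) x j) (rep (clen j) i).
  by move=> j; have [_ _ /(_ _ (xt j)) [i ? ?]] := hrep _ (clen_range j); exists i.
have fc j : (f j < c (clen j))%N by case: (hf j).
have xf : has_type x f by move=> k j <-; case: (hf j).
have [i hi] := a_surj f fc; exists i.
exact/(typed_orbit _ _ _ _ fc (a_lt i) xf (pointT _)).
Qed.
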